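(* For a sufficiently small absolute constant $\delta>0$, $\mathrm{IC}_{\nu,\delta}(h)=\Omega(n/\varepsilon^2)$. In particular, the distributional one-way communication complexity of $h$ under input distribution $\nu$ (with error $\delta$) is $\Omega(n/\varepsilon^2)$.
   Context: Let $0<c<1$ be a fixed sufficiently small constant and $\varepsilon>0$ (tending to $0$) with $1/\varepsilon^2$ and $1/(2\varepsilon^2)$ integers; $\Delta$ denotes Hamming distance. For $S,T\in\{0,1\}^{1/\varepsilon^2}$ of Hamming weight $\frac{1}{2\varepsilon^2}$, the partial function $f_c(S,T)$ is $1$ if $\Delta(S,T)\ge\frac{1}{2\varepsilon^2}+\frac c\varepsilon$ and $0$ if $\Delta(S,T)\le\frac{1}{2\varepsilon^2}-\frac c\varepsilon$. Let $\zeta$ be the distribution in which $S,T$ are independent and uniform among weight-$\frac{1}{2\varepsilon^2}$ strings. In the $n$-fold problem, Alice is given $S_1,\ldots,S_n\in\{0,1\}^{1/\varepsilon^2}$ and Bob is given an index $I\in[n]$ and $T\in\{0,1\}^{1/\varepsilon^2}$, distributed according to $\nu$: $I$ is uniform on $[n]$ independently, $(S_I,T)\sim\zeta$, and $S_j$ for $j\ne I$ are independent and uniform among weight-$\frac{1}{2\varepsilon^2}$ strings. Bob must evaluate $h(S_1,\ldots,S_n,T,I)=f_c(S_I,T)$. Alice sends one message $M$, a randomized function of $S_1,\ldots,S_n$ (private randomness). $M$ is $\delta$-error for $(h,\nu)$ if there is a reconstruction function $R$ with $$\Pr_{\nu,\text{private randomness}}\Big[\big(R(M,T,I)=f_c(S_I,T)\big)\wedge\big(|\Delta(S_I,T)-\tfrac{1}{2\varepsilon^2}|\ge\tfrac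 c\varepsilon\big)\Big]\ge1-\delta.$$ $\mathrm{IC}_{\nu,\delta}(h)=\min I(S_1,\ldots,S_n;M)$ over all $\delta$-error $M$ for $(h,\nu)$, with $I(\cdot;\cdot)$ mutual information. *)

(* Defs.v *)
From HB Require Import structures.
From mathcomp Require Export all_boot all_order all_algebra.
From mathcomp Require Export boolp classical_sets reals constructive_ereal ereal exp.

Set Implicit Arguments.
Unset Strict Implicit.
Unset Printing Implicit Defensive.

Import Order.TTheory GRing.Theory Num.Theory.
Local Open Scope ring_scope.

Definition word (N : nat) : finType := {ffun 'I_N -> bool}.

Definition hweight (N : nat) (s : word N) : nat := #|[pred i | s i]|.

Definition hdist (N : nat) (s t : word N) : nat := #|[pred i | s i != t i]|.

Definition log2 (R : realType) (x : R) : R := ln x / ln 2.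

(* The summand vanishes when p a b = 0, whatever the value of the logarithm. *)
Definition mutual_info (R : realType) (A B : finType) (p : A -> B -> R) : R :=
  \sum_(a : A) \sum_(b : B)
    p a b * log2 (p a b / ((\sum_(b' : B) p a b') * (\sum_(a' : A) p a' b))).

Definition balanced (R : realType) (eps : R) (N : nat) : {set word N} :=
  [set s | (hweight s)%:R == 1 / (2 * eps ^+ 2) :> R]%SET.

Definition unif_balanced (R : realType) (eps : R) (N : nat) (s : word N) : R :=
  if s \in balanced eps N then #|balanced eps N|%:R^-1 else 0.

(* [None] means that the partial function is undefined. *)
Definition f_gap (R : realType) (eps c : R) (N : nat) (s t : word N) :
    option bool :=
  if (s \in balanced eps N) && (t \in balanced eps N) then
    if 1 / (2 * eps ^+ 2) + c / eps <= (hdist s t)%:R then Some true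
    else if (hdist s t)%:R <= 1 / (2 * eps ^+ 2) - c / eps then Some false
    else None
  else None.

Definition zeta (R : realType) (eps : R) (N : nat) (s t : word N) : R :=
  unif_balanced eps s * unif_balanced eps t.

Definition alice_input (N n : nat) : finType := {ffun 'I_n -> word N}.

Definition nu (R : realType) (eps : R) (N n : nat)
    (x : alice_input N n) (t : word N) (i : 'I_n) : R :=
  n%:R^-1 * zeta eps (x i) t * \prod_(j < n | j != i) unif_balanced eps (x j).

Definition nu_alice (R : realType) (eps : R) (N n : nat)
    (x : alice_input N n) : R :=
  \sum_(t : word N) \sum_(i < n) nu eps x t i.

Definition h_gap (R : realType) (eps c : R) (N n : nat)
    (x : alice_input N n) (t : word N) (i : 'I_n) : option bool :=
  f_gap eps c (x i) t.

(* A function of Alice's input using private randomness is given by the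
   conditional law of the message: M x m = Pr[message = m | input = x]. *)
Definition randomized_message (R : realType) (N n : nat) (Msg : finType)
    (M : alice_input N n -> Msg -> R) : Prop :=
  (forall x m, 0 <= M x m) /\ (forall x, \sum_(m : Msg) M x m = 1).

Definition success (R : realType) (eps c : R) (N n : nat) (Msg : finType)
    (rec : Msg -> word N -> 'I_n -> bool)
    (x : alice_input N n) (t : word N) (i : 'I_n) (m : Msg) : bool :=
  (Some (rec m t i) == h_gap eps c x t i) &&
  (c / eps <= `| (hdist (x i) t)%:R - 1 / (2 * eps ^+ 2) |).

Definition success_prob (R : realType) (eps c : R) (N n : nat) (Msg : finType)
    (M : alice_input N n -> Msg -> R)
    (rec : Msg -> word N -> 'I_n -> bool) : R :=
  \sum_(x : alice_input N n) \sum_(t : word N) \sum_(i < n)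
    \sum_(m : Msg | success eps c rec x t i m) nu eps x t i * M x m.

Definition delta_error (R : realType) (eps c delta : R) (N n : nat)
    (Msg : finType) (M : alice_input N n -> Msg -> R) : Prop :=
  randomized_message M /\
  exists rec : Msg -> word N -> 'I_n -> bool,
    1 - delta <= success_prob eps c M rec.

Definition info_cost (R : realType) (eps : R) (N n : nat) (Msg : finType)
    (M : alice_input N n -> Msg -> R) : R :=
  mutual_info (fun x m => nu_alice eps x * M x m).

(* Infimum in the extended reals: +oo when there is no delta-error message.
   Finite message sets lose no generality: replacing a message m by the finite
   function (t, i) |-> rec m t i preserves the success probability and does not
   increase the mutual information. *)
Definition IC (R : realType) (eps c delta : R) (N n : nat) : \bar R :=
  ereal_inf [set v | exists (Msg : finType) (M : alice_input N n -> Msg -> R),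
    delta_error eps c delta M /\ v = (info_cost eps M)%:E]%classic.

(* [{bseq b of bool}] is the type of bit strings of length at most b, so b
   bounds the worst-case length of Alice's message. *)
Definition one_way_cc (R : realType) (eps c delta : R) (N n : nat) : \bar R :=
  ereal_inf [set v | exists (b : nat)
      (M : alice_input N n -> {bseq b of bool} -> R),
    delta_error eps c delta M /\ v = (b%:R)%:E]%classic.

(* Main.v *)
(** Write strings as +-1 vectors, so that X = <s, t> = N - 2 Delta(s, t) with
N = 1 / eps^2. For a message m and an index i, the guesses rec m t i = g(t)
enter only through their barycenter w = E_T [g(T) T], because
E_T [g(T) <s, T>] = <s, w>. A guess that is right with probability close to 1
makes <s, w> close to E |X|, which is of order sqrt N by the second and fourth
moments of X. On the other hand |w|^2 <= 2, so <S_i, w> is subgaussian (up to the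
factor N + 1 lost by comparing balanced strings with the whole cube). By the
Donsker-Varadhan inequality, applied to the product prior with the test function
lam * sum_i <x_i, w_{m, i}> and lam of order sqrt N, a typical value of order
n sqrt N costs information of order n N.

All moments over balanced strings come from one identity for the exchangeable
pair (t, t'), where t' swaps two coordinates of t. *)

Require Import Defs.
From HB Require Import structures.
From mathcomp Require Import all_boot all_order all_algebra all_fingroup.
From mathcomp Require Import boolp classical_sets reals constructive_ereal ereal sequences exp.
From mathcomp Require Import ring lra zify.
Import Order.TTheory GRing.Theory Num.Theory.
Set Implicit Arguments.
Unset Strict Implicit.
Unset Printing Implicit Defensive.
Local Open Scope ring_scope.

(** * Counting: the central binomial coefficient and bit strings of bounded length *)

(** Supplies the factor N + 1 in the comparison of the balanced layer with the cube. From k to k + 1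
    the right side grows by 2 (2k + 3) / (k + 1), which exceeds 4. *)
Lemma expn4_le_central_bin (k : nat) : (4 ^ k <= k.*2.+1 * 'C(k.*2, k))%N.
Proof.
elim: k => [|k IH]; first by rewrite bin0.
have e : (k.+1 * 'C(k.+1.*2, k.+1) = 2 * (k.*2.+1 * 'C(k.*2, k)))%N.
  have e1 := mul_bin_diag k.+1.*2 k; have e2 := mul_bin_down k.*2.+1 k.
  rewrite doubleS /= in e1 e2 *.
  rewrite -e1 e2; nia.
have : (k.+1 * 4 ^ k.+1 <= k.+1 * (k.+1.*2.+1 * 'C(k.+1.*2, k.+1)))%N.
  by rewrite mulnCA e expnS; nia.
by rewrite leq_pmul2l.
Qed.

Lemma card_bseq_bool (b : nat) : (#|{bseq b of bool}| <= 2 ^ b.+1)%N.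
Proof.
rewrite (bij_eq_card (@bseq_tagged_tuple_bij b bool)) card_tagged.
rewrite sumnE big_map big_enum /=.
rewrite (eq_bigr (fun k : 'I_b.+1 => 2 ^ k)%N); last first.
  by move=> k _; rewrite card_tuple card_bool.
rewrite -(big_mkord xpredT (fun k => 2 ^ k)%N).
by have := predn_exp 2 b.+1; rewrite mul1n big_mkord => <-; rewrite leq_pred.
Qed.

(** * Sign vectors and inner products *)

Section Signs.
Variable R : realType.

(** [true] becomes -1: a guess [true] announces a large distance, that is, a negative inner product,
    so guess and inner product agree in sign when the guess is right. *)
Definition sg (b : bool) : R := (-1) ^+ b.

Lemma sg_sqr b : sg b * sg b = 1.
Proof. by case: b; rewrite /sg ?expr1 ?expr0 ?mulr1 ?mulrNN ?mulr1. Qed.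

Definition dotp (N : nat) (v : 'I_N -> R) (t : word N) : R :=
  \sum_i v i * sg (t i).

Definition layer (N k : nat) : {set word N} := [set t : word N | hweight t == k]%SET.

Lemma sum_sg (T : finType) (P : pred T) :
  \sum_i sg (P i) = #|T|%:R - 2 * #|[pred i | P i]|%:R.
Proof.
rewrite -sum1_card -[#|[pred i | P i]|]sum1_card !natr_sum mulr_sumr.
rewrite [X in _ - X]big_mkcond -sumrB; apply: eq_bigr => i _.
rewrite /sg inE /=; by case: (P i); rewrite /= ?expr1 ?expr0; lra.
Qed.

Lemma layer_sum0 (k : nat) (t : word k.*2) :
  t \in layer k.*2 k -> \sum_i sg (t i) = 0.
Proof.
rewrite inE => /eqP tk.
rewrite (sum_sg (fun i => t i)) card_ord.
by rewrite -[#|_|]/(hweight t) tk -muln2 natrM; lra.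
Qed.

Lemma dotp_sg_hdist (N : nat) (s t : word N) :
  dotp (fun i => sg (s i)) t = N%:R - 2 * (hdist s t)%:R.
Proof.
have := sum_sg (fun i => s i != t i); rewrite card_ord -/(hdist s t) => <-.
by apply: eq_bigr => i _; rewrite /sg; case: (s i); case: (t i);
  rewrite /= ?expr1 ?expr0; lra.
Qed.

(** * The exchangeable pair: swapping two coordinates of a balanced string *)

Section Swap.
Variable N : nat.

Definition swapw (i j : 'I_N) (t : word N) : word N := [ffun l => t (tperm i j l)].

Lemma swapwK i j : involutive (swapw i j).
Proof. by move=> t; apply/ffunP => l; rewrite !ffunE tpermK. Qed.

Lemma hweight_swapw i j t : hweight (swapw i j t) = hweight t.
Proof.
rewrite /hweight -!sum1_card [RHS](reindex_inj (@perm_inj _ (tperm i j))).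
by apply: eq_bigl => l; rewrite !inE ffunE.
Qed.

Lemma sum_layer_swapw (k : nat) (F : word N -> R) i j :
  \sum_(t in layer N k) F (swapw i j t) = \sum_(t in layer N k) F t.
Proof.
rewrite [RHS](reindex_inj (inv_inj (swapwK i j))).
by apply: eq_bigl => t; rewrite !inE hweight_swapw.
Qed.

Lemma dotp_swapw (v : 'I_N -> R) i j (t : word N) :
  dotp v t - dotp v (swapw i j t) = (v i - v j) * (sg (t i) - sg (t j)).
Proof.
rewrite /dotp -sumrB; have [<-|nij] := eqVneq i j.
  by rewrite big1 => [|l _]; rewrite ?ffunE ?tperm1 ?perm1; lra.
rewrite (bigD1 i) //= (bigD1 j) 1?eq_sym //= big1 => [|l /andP[li lj]].
  by rewrite !ffunE tpermL tpermR; ring.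
by rewrite ffunE tpermD 1?eq_sym// subrr.
Qed.

(** The linear regression property of the pair: over a uniform ordered pair (i, j), diagonal
    included, the mean of Y - Y' is (2 / N) Y. The cross terms vanish because the signs of [t] sum
    to 0. *)
Lemma sum_swap_differences (v : 'I_N -> R) (t : word N) : \sum_i sg (t i) = 0 ->
  \sum_i \sum_j (dotp v t - dotp v (swapw i j t)) = 2 * N%:R * dotp v t.
Proof.
move=> t0.
transitivity (\sum_i \sum_j (v i * sg (t i) + v j * sg (t j)
                 - v i * sg (t j) - sg (t i) * v j)).
  by apply: eq_bigr => i _; apply: eq_bigr => j _; rewrite dotp_swapw; ring.
under eq_bigr => i _.
  rewrite !sumrB big_split /= sumr_const card_ord -!mulr_sumr t0 mulr0 subr0.
  over.
rewrite sumrB big_split /= -mulr_suml t0 mul0r subr0.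
by rewrite sumrMnl sumr_const card_ord -/(dotp v t) -mulr_natr; ring.
Qed.

End Swap.

(** * Second and fourth moments over the balanced layer *)

Section BalancedMoments.
Variable k : nat.
Hypothesis k_gt0 : (0 < k)%N.
Let N := k.*2.
Let B := layer N k.
Implicit Types (v : 'I_N -> R) (s t : word N).

(* The swap t -> t' is an involution of the layer, so
   sum g(Y)(Y - Y') = 1/2 sum (g(Y) - g(Y'))(Y - Y'). *)
Lemma swap_identity v (g : R -> R) :
  2 * N%:R * \sum_(t in B) g (dotp v t) * dotp v t =
  2^-1 * \sum_i \sum_j \sum_(t in B)
    (g (dotp v t) - g (dotp v (swapw i j t))) * (dotp v t - dotp v (swapw i j t)).
Proof.
have half i j : \sum_(t in B)
      (g (dotp v t) - g (dotp v (swapw i j t))) * (dotp v t - dotp v (swapw i j t))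
    = 2 * \sum_(t in B) g (dotp v t) * (dotp v t - dotp v (swapw i j t)).
  rewrite mulr2n mulrDl mul1r -[X in _ = X + _](sum_layer_swapw _ _ i j).
  rewrite -big_split /=.
  by apply: eq_bigr => t _; rewrite swapwK; ring.
transitivity (\sum_i \sum_j \sum_(t in B)
    g (dotp v t) * (dotp v t - dotp v (swapw i j t))); last first.
  rewrite mulr_sumr; apply: eq_bigr => i _; rewrite mulr_sumr.
  by apply: eq_bigr => j _; rewrite half mulrA mulVf ?pnatr_eq0 // mul1r.
rewrite mulr_sumr.
under [RHS]eq_bigr => i _ do rewrite exchange_big.
rewrite exchange_big; apply: eq_bigr => t tB /=.
under [RHS]eq_bigr => i _ do rewrite -mulr_sumr.
by rewrite -mulr_sumr sum_swap_differences ?(layer_sum0 tB) //; ring.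
Qed.

Let N_gt0 : 0 < N%:R :> R.
Proof. by rewrite ltr0n double_gt0. Qed.

Lemma sum_sqr_differences v :
  \sum_i \sum_j (v i - v j) ^+ 2 =
  2 * N%:R * (\sum_i v i ^+ 2) - 2 * (\sum_i v i) ^+ 2.
Proof.
have sq (a b : R) : (a - b) ^+ 2 = a ^+ 2 + b ^+ 2 - 2 * a * b by ring.
under eq_bigr => i _.
  under eq_bigr => j _ do rewrite sq.
  rewrite sumrB big_split /= sumr_const card_ord -mulr_sumr.
  over.
rewrite sumrB big_split /= -mulr_suml -mulr_sumr sumrMnl sumr_const card_ord.
by rewrite -mulr_natr; ring.
Qed.

(** [swap_identity] with g = id. Each squared sign difference is at most 4, and the squares (v_i -
    v_j)^2 sum to at most 2 N |v|^2. *)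
Lemma sum_dotp_sqr_le v :
  \sum_(t in B) dotp v t ^+ 2 <= 2 * (\sum_i v i ^+ 2) * #|B|%:R.
Proof.
have id2 : 2 * N%:R * \sum_(t in B) dotp v t ^+ 2 = _ := swap_identity v id.
have le4 : \sum_i \sum_j \sum_(t in B)
    (dotp v t - dotp v (swapw i j t)) * (dotp v t - dotp v (swapw i j t))
    <= 4 * #|B|%:R * \sum_i \sum_j (v i - v j) ^+ 2.
  rewrite mulr_sumr.
  apply: ler_sum => i _; rewrite mulr_sumr; apply: ler_sum => j _.
  rewrite -mulrA mulrCA mulr_natl -sumr_const; apply: ler_sum => t _.
  rewrite dotp_swapw -expr2 exprMn mulrC ler_wpM2r ?sqr_ge0 //.
  by rewrite /sg; case: (t i); case: (t j); rewrite ?expr1 ?expr0; lra.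
rewrite sum_sqr_differences in le4.
have Q := sqr_ge0 (\sum_i v i).
have cB : 0 <= #|B|%:R :> R by [].
rewrite -(ler_pM2l (mulr_gt0 (ltr0n _ 2) N_gt0)) id2.
have : 0 <= #|B|%:R * (\sum_i v i) ^+ 2 by exact: mulr_ge0.
nra.
Qed.

(** For sign vectors g = id gives an exact value: (Y - Y')^2 is 4 (1 - s_i s_j) (1 - t_i t_j), whose
    sum over i and j is 4 (N^2 + Y^2) by balance of both strings. The Y^2 moves to the left and
    turns N into N - 1. *)
Lemma sum_dotp_sg_sqr s : s \in B ->
  (N%:R - 1) * \sum_(t in B) dotp (fun i => sg (s i)) t ^+ 2 = N%:R ^+ 2 * #|B|%:R.
Proof.
move=> sB; set v := fun i => sg (s i).
have id2 : 2 * N%:R * \sum_(t in B) dotp v t ^+ 2 = _ := swap_identity v id.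
have e : \sum_i \sum_j \sum_(t in B)
    (dotp v t - dotp v (swapw i j t)) * (dotp v t - dotp v (swapw i j t))
    = 4 * (N%:R ^+ 2 * #|B|%:R + \sum_(t in B) dotp v t ^+ 2).
  under eq_bigr => i _ do rewrite exchange_big.
  rewrite exchange_big /= mulr_natr -sumr_const -big_split /= mulr_sumr.
  apply: eq_bigr => t tB.
  transitivity (4 * \sum_(i < N) \sum_(j < N) (1 - v i * v j - sg (t i) * sg (t j)
      + v i * sg (t i) * (v j * sg (t j)))).
    rewrite mulr_sumr; apply: eq_bigr => i _; rewrite mulr_sumr.
    apply: eq_bigr => j _; rewrite dotp_swapw /v /sg.
    by case: (s i); case: (s j); case: (t i); case: (t j);
      rewrite ?expr1 ?expr0; ring.
  congr (_ * _).
  under eq_bigr => i _.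
    rewrite big_split /= !sumrB -!mulr_sumr (layer_sum0 tB) (layer_sum0 sB).
    rewrite !mulr0 !subr0 sumr_const card_ord -/(dotp v t).
    over.
  rewrite big_split /= sumr_const card_ord -mulr_suml -/(dotp v t).
  by rewrite -mulr_natr; ring.
rewrite e in id2.
lra.
Qed.

(** [swap_identity] with g(y) = y^3 reduces the fourth moment to the second, since a swap moves Y by
    at most 4. *)
Lemma sum_dotp_sg_pow4 s :
  \sum_(t in B) dotp (fun i => sg (s i)) t ^+ 4 <=
  12 * N%:R * \sum_(t in B) dotp (fun i => sg (s i)) t ^+ 2.
Proof.
set v := fun i => sg (s i).
have id4 := swap_identity v (fun y => y ^+ 3).
set Q := \sum_(t in B) dotp v t ^+ 2.
have le : \sum_i \sum_j \sum_(t in B)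
    (dotp v t ^+ 3 - dotp v (swapw i j t) ^+ 3) * (dotp v t - dotp v (swapw i j t))
    <= N%:R * (N%:R * (48 * Q)).
  have cst (x : R) : N%:R * x = \sum_(i < N) x.
    by rewrite sumr_const card_ord mulr_natl.
  rewrite cst; apply: ler_sum => i _; rewrite cst; apply: ler_sum => j _.
  have -> : 48 * Q = \sum_(t in B)
      (24 * dotp v t ^+ 2 + 24 * dotp v (swapw i j t) ^+ 2).
    rewrite big_split /= -!mulr_sumr (sum_layer_swapw _ (fun t => dotp v t ^+ 2)).
    by rewrite -/Q; ring.
  apply: ler_sum => t _.
  have d16 : (dotp v t - dotp v (swapw i j t)) ^+ 2 <= 16.
    rewrite dotp_swapw /v /sg.
    by case: (s i); case: (s j); case: (t i); case: (t j);
      rewrite ?expr1 ?expr0; lra.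
  move: (dotp v t) (dotp v (swapw i j t)) d16 => x y d16.
  have -> : (x ^+ 3 - y ^+ 3) * (x - y)
      = (x - y) ^+ 2 * (x ^+ 2 + x * y + y ^+ 2) by ring.
  have xy0 := sqr_ge0 (x - y); have xy1 := sqr_ge0 (x + y).
  apply: (@le_trans _ _ (16 * (x ^+ 2 + x * y + y ^+ 2))).
    by rewrite ler_wpM2r //; nra.
  (* 16 (x^2 + x y + y^2) <= 24 (x^2 + y^2), because x y <= (x^2 + y^2) / 2. *)
  nra.
have p4 t : dotp v t ^+ 3 * dotp v t = dotp v t ^+ 4 by rewrite -exprSr.
rewrite (eq_bigr _ (fun t _ => p4 t)) in id4.
rewrite -(ler_pM2l (mulr_gt0 (ltr0n _ 2) N_gt0)) id4.
nra.
Qed.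

End BalancedMoments.
End Signs.

(** * Size of the layer, and exponential moments over the cube and the layer *)

Lemma card_layer (N k : nat) : #|layer N k| = 'C(N, k).
Proof.
rewrite -[N in RHS]card_ord -card_draws.
pose f (A : {set 'I_N}) : word N := [ffun i => i \in A].
have injf : injective f.
  by move=> A A' /ffunP e; apply/setP => i; have := e i; rewrite !ffunE.
rewrite -(card_imset _ injf); apply: eq_card => t; apply/idP/imsetP.
  rewrite inE => tk; exists [set i | t i]%SET; rewrite ?inE.
    by rewrite -(eqP tk); apply/eqP/eq_card => i; rewrite !inE.
  by apply/ffunP => i; rewrite ffunE inE.
move=> [A]; rewrite inE => /eqP Ak ->; rewrite inE -Ak.
by apply/eqP/eq_card => i; rewrite !inE ffunE.
Qed.

Section Subgaussian.
Variable R : realType.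

(** The sharp exponent is x^2 / 2; the weaker 2 x^2 needs only 1 + y <= e^y. For x^2 <= 1/2,
    bounding e^y by 1 / (1 - y) gives 2 / (1 - x^2) <= 2 (1 + 2 x^2); beyond that, y <= 2 y^2
    already holds for y = x and y = -x. *)
Lemma expR_sym_le (x : R) : expR x + expR (- x) <= 2 * expR (2 * x ^+ 2).
Proof.
have [x2|x2] := leP (x ^+ 2) 2^-1.
  have x1 : `|x| < 1.
    by rewrite -(@ltr_pXn2r _ 2) ?nnegrE // real_normK ?num_real //; lra.
  move: x1; rewrite ltr_norml => /andP[xl xr].
  have ub (y : R) : y < 1 -> expR y <= (1 - y)^-1.
    move=> y1; rewrite -[y in expR y]opprK expRN lef_pV2 ?posrE ?expR_gt0 ?subr_gt0 //.
    exact: expR_ge1Dx.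
  have e := expR_ge1Dx (2 * x ^+ 2).
  have u1 := ub _ xr; have := ub (- x) ltac:(lra); rewrite opprK => u2.
  have : (1 - x)^-1 + (1 + x)^-1 <= 2 * (1 + 2 * x ^+ 2).
    have -> : (1 - x)^-1 + (1 + x)^-1 = 2 / (1 - x ^+ 2).
      by field; rewrite !lt0r_neq0 //; lra.
    by rewrite ler_pdivrMr; nra.
  lra.
have bd (y : R) : y ^+ 2 = x ^+ 2 -> expR y <= expR (2 * x ^+ 2).
  move=> yx; rewrite ler_expR -yx; rewrite -yx in x2.
  by have := sqr_ge0 (y - 2^-1); nra.
by have := bd x erefl; have := bd (- x) (sqrrN x); lra.
Qed.

Lemma cube_mgf (N : nat) (v : 'I_N -> R) :
  \sum_(s : word N) expR (dotp v s) <= 2 ^+ N * expR (2 * \sum_i v i ^+ 2).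
Proof.
under eq_bigr => s _ do rewrite /dotp expR_sum.
rewrite -(bigA_distr_bigA (fun i b => expR (v i * sg R b))).
rewrite mulr_sumr expR_sum -[in 2 ^+ N](card_ord N) -prodr_const -big_split /=.
apply: ler_prod => i _; rewrite big_bool /=.
rewrite /sg expr1 expr0 mulr1 mulrN1 addr_ge0 ?expR_ge0 //=.
by rewrite addrC expR_sym_le.
Qed.

(** The terms are positive, so the sum extends to the cube, where the coordinates are independent;
    normalizing by the layer instead of the cube costs N + 1. *)
Lemma layer_mgf (k : nat) (v : 'I_k.*2 -> R) :
  \sum_(s in layer k.*2 k) expR (dotp v s) <=
  k.*2.+1%:R * #|layer k.*2 k|%:R * expR (2 * \sum_i v i ^+ 2).
Proof.
apply: (@le_trans _ _ (\sum_(s : word k.*2) expR (dotp v s))).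
  rewrite big_mkcond /=; apply: ler_sum => s _.
  by case: ifP => // _; exact: expR_ge0.
apply: le_trans (cube_mgf v) _; rewrite ler_wpM2r ?expR_ge0 //.
rewrite card_layer -natrM -natrX ler_nat.
have -> : (2 ^ k.*2 = 4 ^ k)%N by rewrite -mul2n expnM.
exact: expn4_le_central_bin.
Qed.

End Subgaussian.

(** * Barycenter of the guesses and its correlation with the hidden string *)

Section Correlation.
Variables (R : realType) (k : nat).
Hypothesis k_gt0 : (0 < k)%N.
Let N := k.*2.
Let B := layer N k.

Lemma card_layer_gt0 : 0 < #|B|%:R :> R.
Proof. by rewrite ltr0n card_layer bin_gt0 /N -addnn leq_addl. Qed.

Definition bary (g : word N -> bool) (i : 'I_N) : R :=
  #|B|%:R^-1 * \sum_(t in B) sg R (g t) * sg R (t i).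

Lemma dotp_bary g (v : 'I_N -> R) :
  \sum_i bary g i * v i = #|B|%:R^-1 * \sum_(t in B) sg R (g t) * dotp v t.
Proof.
under [in RHS]eq_bigr => t _ do rewrite mulr_sumr.
rewrite exchange_big mulr_sumr; apply: eq_bigr => i _ /=.
rewrite /bary -mulrA mulr_suml; congr (_ * _).
by apply: eq_bigr => t _; ring.
Qed.

(** A self-bounding argument: |w|^2 is the mean of g(T) <w, T>, which is at most the mean of <w,
    T>^2 / 4 + 1, hence at most |w|^2 / 2 + 1 by the second moment. *)
Lemma bary_sqr_le g : \sum_i bary g i ^+ 2 <= 2.
Proof.
have K0 := card_layer_gt0.
under eq_bigr => i _ do rewrite expr2.
rewrite dotp_bary ler_pdivrMl //.
set W := \sum_(t in B) _.
have e : #|B|%:R * \sum_i bary g i ^+ 2 = W.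
  under eq_bigr => i _ do rewrite expr2.
  by rewrite dotp_bary mulVKf ?gt_eqF.
have le1 : W <= \sum_(t in B) (dotp (bary g) t ^+ 2 / 4 + 1).
  apply: ler_sum => t _; have := sqr_ge0 (dotp (bary g) t / 2 - sg R (g t)).
  by have := sg_sqr R (g t); nra.
have le2 := sum_dotp_sqr_le k_gt0 (bary g).
rewrite big_split /= -mulr_suml sumr_const in le1.
rewrite -/N -/B in le2; move: le1 le2; rewrite -e -mulr_natr mul1r -/B; lra.
Qed.

(** A polynomial minorant, so that only second and fourth moments are needed; y^2 / 2 - y^4 / 54
    touches |y| at |y| = 3. A wrong guess costs 2 |y| <= y^2 / 8 + 8, whence 3/8 = 1/2 - 1/8 and the
    penalty 8. *)
Lemma sgM_ge (b ok : bool) (y : R) : (ok -> 0 <= sg R b * y) ->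
  3 / 8 * y ^+ 2 - y ^+ 4 / 54 - 8 * (~~ ok)%:R <= sg R b * y.
Proof.
move=> h.
have abs : y ^+ 2 / 2 - y ^+ 4 / 54 <= `|y|.
  have -> : y ^+ 2 = `|y| ^+ 2 by rewrite real_normK ?num_real.
  have -> : y ^+ 4 = `|y| ^+ 4.
    by rewrite [RHS](exprM _ 2 2) real_normK ?num_real // -exprM.
  (* 1 - z + 4 z^3 / 27 = (1 - 2 z / 3)^2 (1 + z / 3), at z = |y| / 2 *)
  have -> : `|y| ^+ 2 / 2 - `|y| ^+ 4 / 54
     = `|y| - `|y| * ((1 - `|y| / 3) ^+ 2 * (1 + `|y| / 6)) by field.
  by rewrite gerBl mulr_ge0 // mulr_ge0 ?sqr_ge0 //; have := normr_ge0 y; lra.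
have ny : `|sg R b * y| = `|y| by rewrite normrM /sg normrX normrN1 expr1n mul1r.
case: ok h => [/(_ isT)/ger0_norm h|_].
  by rewrite -h ny /= mulr0; have := sqr_ge0 y; lra.
have lo : - `|y| <= sg R b * y by rewrite -ny lerNnormlW.
have y2 : `|y| ^+ 2 = y ^+ 2 by rewrite real_normK ?num_real.
have := sqr_ge0 (`|y| - 8); rewrite /= mulr1; nra.
Qed.

(** [sgM_ge] averaged over t at y = eps X, the scale at which the second moment is at least 1 and
    the fourth at most 12 times the second. *)
Lemma bary_correlation (eps : R) (s : word N) (g ok : word N -> bool) :
  0 < eps -> N%:R = 1 / eps ^+ 2 -> s \in B ->
  (forall t, t \in B -> ok t ->
     0 <= sg R (g t) * dotp (fun i => sg R (s i)) t) ->
  1 / 8 - 8 * (#|B|%:R^-1 * \sum_(t in B) (~~ ok t)%:R) <= eps * dotp (bary g) s.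
Proof.
move=> e0 Ne sB h; have K0 := card_layer_gt0.
rewrite [X in _ <= _ * X]dotp_bary [X in _ <= X]mulrCA.
rewrite -(ler_pM2l K0) mulVKf ?gt_eqF //.
rewrite mulrBr [X in _ - X]mulrCA mulVKf ?gt_eqF // [X in _ <= X]mulr_sumr.
set X := dotp _ in h *.
have le1 : \sum_(t in B) (3 / 8 * (eps * X t) ^+ 2 - (eps * X t) ^+ 4 / 54 -
    8 * (~~ ok t)%:R) <= \sum_(t in B) eps * (sg R (g t) * X t).
  apply: ler_sum => t tB; rewrite [X in _ <= X]mulrCA; apply: sgM_ge => okt.
  by rewrite mulrCA pmulr_rge0 // h.
apply: le_trans le1.
rewrite !sumrB -!mulr_sumr -mulr_suml lerD2r.
under eq_bigr => t _ do rewrite exprMn.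
under [X in _ - X / _]eq_bigr => t _ do rewrite exprMn.
rewrite -!mulr_sumr.
have m4 := sum_dotp_sg_pow4 R k_gt0 s; have m2 := sum_dotp_sg_sqr R sB.
rewrite -/N -/B -/X in m4 m2.
set Q := \sum_(t in B) X t ^+ 2 in m4 m2 *.
set F := \sum_(t in B) X t ^+ 4 in m4 *.
have eN : eps ^+ 2 * N%:R = 1 by rewrite Ne; field; rewrite gt_eqF.
have Q0 : 0 <= Q by apply: sumr_ge0 => t _; exact: sqr_ge0.
have F4 : eps ^+ 4 * F <= 12 * (eps ^+ 2 * Q).
  have <- : eps ^+ 4 * (12 * N%:R * Q) = 12 * (eps ^+ 2 * Q).
    by transitivity (eps ^+ 2 * N%:R * (12 * (eps ^+ 2 * Q)));
      [ring | rewrite eN mul1r].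
  by rewrite ler_pM2l // exprn_gt0.
have N1 : 1 <= N%:R :> R by rewrite ler1n double_gt0.
have Q2 : #|B|%:R <= eps ^+ 2 * Q.
  have -> : #|B|%:R = eps ^+ 2 * (eps ^+ 2 * (N%:R ^+ 2 * #|B|%:R)) :> R.
    by transitivity ((eps ^+ 2 * N%:R) ^+ 2 * #|B|%:R);
      [rewrite eN expr1n mul1r | ring].
  rewrite -m2 ler_pM2l ?exprn_gt0 // mulrA ler_piMl //.
  by rewrite mulrBr eN; have := exprn_gt0 2 e0; lra.
(* The coefficient left on the second moment is 3/8 - 12/54 = 11/72 >= 1/8. *)
lra.
Qed.
End Correlation.

(** * Mutual information: a variational lower bound and a cardinality upper bound *)

Section Information.
Variables (R : realType) (A Msg : finType) (P : A -> R) (M : A -> Msg -> R).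
Hypotheses (P0 : forall x, 0 <= P x) (P1 : \sum_x P x = 1).
Hypotheses (M0 : forall x m, 0 <= M x m) (M1 : forall x, \sum_m M x m = 1).

Lemma ln_le_sub1 (x : R) : 0 < x -> ln x <= x - 1.
Proof.
move=> x0; have -> : ln x = ln (1 + (x - 1)) by congr ln; ring.
by rewrite le_ln1Dx //; lra.
Qed.

Lemma ln2_gt0 : 0 < ln 2 :> R. Proof. by rewrite ln_gt0 //; lra. Qed.

Lemma ln2_le1 : ln 2 <= 1 :> R.
Proof. by have := @ln_le_sub1 2 ltac:(lra); lra. Qed.

Let out m := \sum_x P x * M x m.

Lemma joint_eq0 x m : out m = 0 -> P x * M x m = 0.
Proof.
move=> o0; apply/eqP; move/eqP: o0; rewrite psumr_eq0 => [/allP/(_ x)|y _].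
  by rewrite mem_index_enum; apply.
by rewrite mulr_ge0.
Qed.

Lemma mutual_info_nats : mutual_info (fun x m => P x * M x m) * ln 2 =
  \sum_x \sum_m P x * M x m * ln (P x * M x m / (P x * out m)).
Proof.
rewrite /mutual_info mulr_suml; apply: eq_bigr => x _.
rewrite mulr_suml; apply: eq_bigr => m _.
rewrite /log2 -mulr_sumr M1 mulr1 -/(out m) -mulrA divfK //.
by rewrite gt_eqF // ln2_gt0.
Qed.

(* Donsker-Varadhan: p ln (p / r) >= p psi + p - r e^psi for psi = phi - C. *)
Lemma mutual_info_ge (phi : A -> Msg -> R) (C : R) :
  (forall m, \sum_x P x * expR (phi x m) <= expR C) ->
  \sum_x \sum_m P x * M x m * phi x m - C <=
  mutual_info (fun x m => P x * M x m) * ln 2.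
Proof.
move=> mgf; rewrite mutual_info_nats.
have pt x m : P x * M x m * (phi x m - C + 1) - out m * (P x * expR (phi x m) / expR C)
   <= P x * M x m * ln (P x * M x m / (P x * out m)).
  have o0 y : 0 <= out y by apply: sumr_ge0 => z _; rewrite mulr_ge0.
  have [p0|pn] := eqVneq (P x * M x m) 0.
    by rewrite p0 !mul0r sub0r oppr_le0 !mulr_ge0 ?invr_ge0 ?expR_ge0 ?o0.
  have p0 : 0 < P x * M x m by rewrite lt0r pn mulr_ge0.
  have o1 : 0 < out m.
    by rewrite lt0r o0 andbT; apply: contraNneq pn => /(@joint_eq0 x) ->.
  have [Px Mx] : P x != 0 /\ M x m != 0.
    by split; apply: contraNneq pn => ->; rewrite ?mul0r ?mulr0.
  have Px0 : 0 < P x by rewrite lt0r Px P0.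
  set r := P x * out m; have r0 : 0 < r by rewrite mulr_gt0.
  have re0 : 0 < r * expR (phi x m - C) by rewrite mulr_gt0 ?expR_gt0.
  have le := ln_le_sub1 (divr_gt0 re0 p0).
  rewrite ln_div ?posrE // lnM ?posrE ?expR_gt0 // expRK in le.
  rewrite ln_div ?posrE //.
  have le' := ler_wpM2l (ltW p0) le.
  have ee : P x * M x m * (r * expR (phi x m - C) / (P x * M x m) - 1) =
     out m * (P x * expR (phi x m) / expR C) - P x * M x m.
    rewrite expRB /r; field; rewrite Px Mx /=.
    by rewrite gt_eqF ?expR_gt0.
  rewrite ee in le'; lra.
have le1 : \sum_x \sum_m (P x * M x m * (phi x m - C + 1)
      - out m * (P x * expR (phi x m) / expR C))
   <= \sum_x \sum_m P x * M x m * ln (P x * M x m / (P x * out m)).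
  by apply: ler_sum => x _; apply: ler_sum => m _.
apply: le_trans le1.
have sP : \sum_x \sum_m P x * M x m = 1.
  by under eq_bigr => x _ do rewrite -mulr_sumr M1 mulr1.
have e1 : \sum_x \sum_m P x * M x m * (phi x m - C + 1) =
    \sum_x \sum_m P x * M x m * phi x m - C + 1.
  transitivity (\sum_x \sum_m (P x * M x m * phi x m + P x * M x m * (1 - C))).
    by apply: eq_bigr => x _; apply: eq_bigr => m _; ring.
  under eq_bigr => x _ do rewrite big_split /= -mulr_suml.
  by rewrite big_split /= -mulr_suml sP; ring.
under [X in _ <= X]eq_bigr => x _ do rewrite sumrB.
rewrite sumrB e1.
(* For each m the hypothesis on [phi] bounds the sum over x by [out m]; the total is at most 1 and
   cancels the + 1 in [e1]. *)
have : \sum_x \sum_m out m * (P x * expR (phi x m) / expR C) <= 1.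
  rewrite exchange_big /= -sP [X in _ <= X]exchange_big /=; apply: ler_sum => m _.
  rewrite -mulr_sumr -/(out m) ler_piMr //.
    by apply: sumr_ge0 => x _; rewrite mulr_ge0.
  by rewrite -mulr_suml ler_pdivrMr ?expR_gt0 // mul1r.
lra.
Qed.

(** Compares [out] with the uniform law on messages: ln y <= y - 1 at y = M / (out K) leaves ln K
    plus terms whose total is at most 0. *)
Lemma mutual_info_le_card :
  mutual_info (fun x m => P x * M x m) * ln 2 <= ln #|Msg|%:R.
Proof.
rewrite mutual_info_nats.
have sP : \sum_x \sum_m P x * M x m = 1.
  by under eq_bigr => x _ do rewrite -mulr_sumr M1 mulr1.
have K0 : 0 < #|Msg|%:R :> R.
  rewrite ltr0n lt0n; apply/eqP => /card0_eq K0.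
  move/esym/eqP: sP; rewrite big1 ?oner_eq0 // => x _.
  by rewrite big_pred0 // => m; have := K0 m.
set K := #|Msg|%:R in K0 *.
have pt x m : P x * M x m * ln (P x * M x m / (P x * out m)) <=
    P x * M x m * ln K - P x * M x m + P x * M x m / out m / K.
  have [p0|pn] := eqVneq (P x * M x m) 0; first by rewrite p0 !mul0r; lra.
  have p0 : 0 < P x * M x m by rewrite lt0r pn mulr_ge0.
  have o1 : 0 < out m.
    rewrite lt0r; apply/andP; split.
      by apply: contraNneq pn => /(@joint_eq0 x) ->.
    by apply: sumr_ge0 => z _; rewrite mulr_ge0.
  have [Px Mx] : P x != 0 /\ M x m != 0.
    by split; apply: contraNneq pn => ->; rewrite ?mul0r ?mulr0.
  have Mx0 : 0 < M x m by rewrite lt0r Mx M0.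
  have -> : P x * M x m / (P x * out m) = (M x m / out m / K) * K.
    by field; rewrite Px !gt_eqF.
  rewrite lnM ?posrE ?divr_gt0 //.
  have := @ln_le_sub1 (M x m / out m / K); rewrite !divr_gt0 // => /(_ isT) le.
  have := ler_wpM2l (ltW p0) le.
  (* Replaces one of the two factors [M x m] by 1, so that the sum over x reproduces [out m] and
     cancels the denominator. *)
  have M_le1 : M x m <= 1.
    by rewrite -(M1 x) (bigD1 m) //= lerDl sumr_ge0.
  have : P x * M x m * (M x m / out m / K) <= P x * M x m / out m / K.
    have -> : P x * M x m * (M x m / out m / K) = M x m * (P x * M x m / out m / K).
      by ring.
    by rewrite ler_piMl // !divr_ge0 // ltW.
  lra.
apply: (@le_trans _ _ (\sum_x \sum_m (P x * M x m * ln K - P x * M x m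
     + P x * M x m / out m / K))).
  by apply: ler_sum => x _; apply: ler_sum => m _.
under eq_bigr => x _ do rewrite big_split sumrB /= -mulr_suml.
rewrite big_split sumrB /= -mulr_suml sP.
have : \sum_x \sum_m P x * M x m / out m / K <= 1.
  rewrite exchange_big /=.
  have -> : 1 = \sum_(m : Msg) K^-1.
    by rewrite sumr_const -mulr_natl mulfV // gt_eqF.
  apply: ler_sum => m _; rewrite -!mulr_suml -/(out m).
  have [->|on] := eqVneq (out m) 0; first by rewrite !mul0r invr_ge0 ltW.
  by rewrite mulfV // mul1r.
lra.
Qed.

End Information.

(** * Information cost of a message for the n-fold problem *)

Section Protocol.
Variables (R : realType) (eps c : R) (k n : nat).
Let N := k.*2.
Hypotheses (eps_gt0 : 0 < eps) (c_gt0 : 0 < c) (n_gt0 : (0 < n)%N).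
Hypothesis NE : N%:R = 1 / eps ^+ 2 :> R.

Lemma half_invE : 1 / (2 * eps ^+ 2) = k%:R :> R.
Proof.
have kE : k%:R = N%:R / 2 :> R by rewrite /N -muln2 natrM; field.
by rewrite kE NE; field; rewrite gt_eqF.
Qed.

Lemma balancedE : balanced eps N = layer N k.
Proof. by apply/setP => s; rewrite !inE half_invE eqr_nat. Qed.

Lemma k_gt0 : (0 < k)%N.
Proof.
have : 0 < N%:R :> R by rewrite NE divr_gt0 // exprn_gt0.
by rewrite ltr0n double_gt0.
Qed.

Let K : R := #|layer N k|%:R.
Let u : word N -> R := unif_balanced eps (N := N).

Let K_gt0 : 0 < K := card_layer_gt0 R k.

Lemma unif_balanced_sum (F : word N -> R) :
  \sum_t u t * F t = K^-1 * \sum_(t in layer N k) F t.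
Proof.
rewrite mulr_sumr [RHS]big_mkcond; apply: eq_bigr => t _.
by rewrite /u /unif_balanced balancedE; case: ifP; rewrite ?mul0r.
Qed.

Lemma unif_balanced_ge0 t : 0 <= u t.
Proof. by rewrite /u /unif_balanced; case: ifP => // _; rewrite invr_ge0. Qed.

Lemma unif_balanced_sum1 : \sum_t u t = 1.
Proof.
under eq_bigr => t _ do rewrite -[u t]mulr1.
by rewrite unif_balanced_sum sumr_const mulVf // gt_eqF.
Qed.

Let P (x : alice_input N n) : R := \prod_i u (x i).

Lemma prior_ge0 x : 0 <= P x.
Proof. by apply: prodr_ge0 => i _; exact: unif_balanced_ge0. Qed.

Lemma prior_sum1 : \sum_x P x = 1.
Proof.
rewrite -(bigA_distr_bigA (fun (_ : 'I_n) s => u s)).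
by apply: big1 => i _; exact: unif_balanced_sum1.
Qed.

Lemma prior_support x i : P x != 0 -> x i \in layer N k.
Proof.
move=> /prodf_neq0/(_ i isT); rewrite /u /unif_balanced balancedE.
by case: ifP => // _; rewrite eqxx.
Qed.

(** The factor for [x i] in [zeta] completes the product over j != i: under [nu] the inputs x, t and
    i are independent. *)
Lemma nuE x t i : nu eps x t i = n%:R^-1 * u t * P x.
Proof. by rewrite /nu /zeta /P [in RHS](bigD1 i) //= /u; ring. Qed.

Lemma nu_aliceE x : nu_alice eps x = P x.
Proof.
have n_neq0 : n%:R != 0 :> R by rewrite pnatr_eq0 -lt0n.
transitivity (\sum_t u t * P x); last first.
  by rewrite -mulr_suml unif_balanced_sum1 mul1r.
apply: eq_bigr => t _.
rewrite (eq_bigr _ (fun i _ => nuE x t i)) sumr_const card_ord -[LHS]mulr_natl.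
by field.
Qed.

Lemma info_costE (Msg : finType) (M : alice_input N n -> Msg -> R) :
  info_cost eps M = mutual_info (fun x m => P x * M x m).
Proof.
by rewrite /info_cost; congr mutual_info; apply/funext => x; apply/funext => m;
  rewrite nu_aliceE.
Qed.

Variables (Msg : finType) (M : alice_input N n -> Msg -> R).
Hypothesis M_ok : randomized_message M.
Variable rec : Msg -> word N -> 'I_n -> bool.

(** Puts the pair (x, m) outermost, so that the inner sum, for fixed i, is the success probability
    over t alone, as [bary_correlation] requires. *)
Lemma success_probE : success_prob eps c M rec =
  n%:R^-1 * \sum_x \sum_m P x * M x m *
    \sum_i \sum_t u t * (success eps c rec x t i m)%:R.
Proof.
rewrite mulr_sumr; apply: eq_bigr => x _; rewrite mulr_sumr.
transitivity (\sum_t \sum_i \sum_m n%:R^-1 *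
   (P x * M x m * (u t * (success eps c rec x t i m)%:R))).
  apply: eq_bigr => t _; apply: eq_bigr => i _; rewrite big_mkcond.
  apply: eq_bigr => m _; rewrite nuE; case: success => /=; ring.
under eq_bigr => t _ do rewrite exchange_big.
rewrite exchange_big /=; apply: eq_bigr => m _.
rewrite exchange_big !mulr_sumr /=; apply: eq_bigr => i _.
by rewrite !mulr_sumr.
Qed.

(** Since c / eps > 0, a defined value of [f_gap] determines the sign of N - 2 Delta. *)
Lemma success_sign x t i m : success eps c rec x t i m ->
  0 <= sg R (rec m t i) * dotp (fun j => sg R (x i j)) t.
Proof.
rewrite /success /h_gap /f_gap half_invE dotp_sg_hdist => /andP[/eqP].
have ce : 0 < c / eps by rewrite divr_gt0.
have -> : N%:R = 2 * k%:R :> R by rewrite /N -muln2 natrM mulrC.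
case: ifP => // _; case: ifP => [h [->] _|_].
  by rewrite /sg expr1; lra.
by case: ifP => // h [->] _; rewrite /sg expr0; lra.
Qed.

Let w m i := bary R (k := k) (fun t => rec m t i).

Lemma expected_correlation :
  n%:R * (1 / 8 - 8 * (1 - success_prob eps c M rec)) <=
  eps * \sum_x \sum_m P x * M x m * \sum_i dotp (w m i) (x i).
Proof.
have [M0 M1] := M_ok.
have sP : \sum_x \sum_m P x * M x m = 1.
  by under eq_bigr => x _ do rewrite -mulr_sumr M1 mulr1; exact: prior_sum1.
have -> : n%:R * (1 / 8 - 8 * (1 - success_prob eps c M rec)) =
    \sum_x \sum_m P x * M x m * \sum_i (1 / 8 - 8 +
      8 * \sum_t u t * (success eps c rec x t i m)%:R).
  transitivity (n%:R * (1 / 8 - 8) * 1 + 8 * (n%:R * success_prob eps c M rec)).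
    by ring.
  rewrite success_probE mulVKf ?pnatr_eq0 -?lt0n // -[X in _ * X + _]sP.
  rewrite !mulr_sumr -big_split /=.
  apply: eq_bigr => x _; rewrite !mulr_sumr -big_split /=; apply: eq_bigr => m _.
  rewrite big_split /= sumr_const card_ord -mulr_sumr.
  by rewrite -[(_ - _) *+ n]mulr_natl; ring.
rewrite mulr_sumr; apply: ler_sum => x _.
rewrite mulr_sumr; apply: ler_sum => m _.
(* Inputs of prior 0 are discarded, because [bary_correlation] needs each [x i] balanced. *)
have [P0|Pn] := eqVneq (P x) 0; first by rewrite P0 !mul0r mulr0.
rewrite mulrCA ler_wpM2l ?mulr_ge0 ?prior_ge0 // mulr_sumr.
apply: ler_sum => i _.
have := @bary_correlation R k k_gt0 eps (x i) (fun t => rec m t i)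
  (fun t => success eps c rec x t i m) eps_gt0 NE (prior_support i Pn).
move=> /(_ (fun t _ => @success_sign x t i m)); apply: le_trans.
rewrite -/K -unif_balanced_sum.
have -> : \sum_t u t * (~~ success eps c rec x t i m)%:R =
    1 - \sum_t u t * (success eps c rec x t i m)%:R.
  rewrite -[X in _ = X - _]unif_balanced_sum1 -sumrB; apply: eq_bigr => t _.
  by case: success => /=; ring.
lra.
Qed.

(** For fixed m the vectors [w m i] are constants and the [x i] independent, so the mean splits into
    n factors, each bounded by [layer_mgf] with |w|^2 <= 2. The bound is uniform in m, as
    [mutual_info_ge] demands. *)
Lemma correlation_mgf (lam : R) m :
  \sum_x P x * expR (lam * \sum_i dotp (w m i) (x i)) <=
  expR (n%:R * (ln N.+1%:R + 4 * lam ^+ 2)).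
Proof.
have e x : P x * expR (lam * \sum_i dotp (w m i) (x i)) =
    \prod_i (u (x i) * expR (dotp (fun j => lam * w m i j) (x i))).
  rewrite big_split /= -expR_sum mulr_sumr; congr (_ * expR _).
  by apply: eq_bigr => i _; rewrite mulr_sumr; apply: eq_bigr => j _; rewrite mulrA.
under eq_bigr => x _ do rewrite e.
rewrite -(bigA_distr_bigA (fun i s => u s * expR (dotp (fun j => lam * w m i j) s))).
rewrite expRM_natl -[n in _ ^+ n]card_ord -prodr_const; apply: ler_prod => i _.
apply/andP; split.
  by apply: sumr_ge0 => s _; rewrite mulr_ge0 ?unif_balanced_ge0 ?expR_ge0.
rewrite unif_balanced_sum ler_pdivrMl //.
apply: le_trans (layer_mgf _) _.
rewrite -/N -/K expRD lnK ?posrE ?ltr0n // mulrCA -mulrA ler_pM2l ?ltr0n //.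
rewrite ler_pM2l // ler_expR.
under eq_bigr => j _ do rewrite exprMn.
rewrite -mulr_sumr.
have := @bary_sqr_le R k k_gt0 (fun t => rec m t i); rewrite -/(w m i) => b.
have := ler_wpM2l (sqr_ge0 lam) b; lra.
Qed.

(** Donsker-Varadhan with lam = theta / eps, so that lam^2 = theta^2 N; gain and quadratic loss are
    then both of order n N, and a small theta makes the gain win. *)
Lemma info_cost_ge (theta : R) : 0 <= theta ->
  n%:R * (theta * N%:R * (1 / 8 - 8 * (1 - success_prob eps c M rec))
    - ln N.+1%:R - 4 * theta ^+ 2 * N%:R) <= info_cost eps M * ln 2.
Proof.
move=> th0; have [M0 M1] := M_ok; rewrite info_costE.
have lb := @mutual_info_ge R _ Msg P M prior_ge0 prior_sum1 M0 M1
  (fun x m => theta / eps * \sum_i dotp (w m i) (x i)) _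
  (correlation_mgf (theta / eps)).
apply: le_trans lb => /=.
have corr := expected_correlation.
rewrite (eq_bigr (fun x => theta / eps *
    \sum_m P x * M x m * \sum_i dotp (w m i) (x i))); last first.
  by move=> x _; rewrite mulr_sumr; apply: eq_bigr => m _; ring.
rewrite -mulr_sumr.
set S := \sum_x _ in corr *.
have -> : theta / eps * S = theta * N%:R * (eps * S).
  by rewrite NE; field; rewrite gt_eqF.
have -> : (theta / eps) ^+ 2 = theta ^+ 2 * N%:R.
  by rewrite NE; field; rewrite gt_eqF.
have := ler_wpM2l (mulr_ge0 th0 (ler0n R N)) corr; lra.
Qed.

End Protocol.

(** * Choice of constants and the two lower bounds *)

(** Writing e^(a N) as a square bounds it below by (1 + a N / 2)^2, whose quadratic term is at least
    2 N once a^2 N >= 8. *)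
Lemma ln_succ_le (R : realType) (a : R) (N : nat) :
  0 < a -> 8 / a ^+ 2 <= N%:R -> (0 < N)%N -> ln N.+1%:R <= a * N%:R.
Proof.
move=> a0 aN N0; have N1 : 1 <= N%:R :> R by rewrite ler1n.
rewrite -(expRK (a * N%:R)) ler_ln ?posrE ?ltr0n ?expR_gt0 //.
have -> : a * N%:R = a * N%:R / 2 + a * N%:R / 2 by lra.
have e := expR_ge1Dx (a * N%:R / 2).
have p : 0 <= a * N%:R / 2 by rewrite divr_ge0 ?mulr_ge0 // ltW.
rewrite expRD -natr1; rewrite ler_pdivrMr ?exprn_gt0 // in aN.
apply: le_trans (ler_pM _ _ e e); [|lra|lra].
have : 8 * N%:R <= N%:R * a ^+ 2 * N%:R by rewrite ler_wpM2r.
nra.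
Qed.

(** Takes theta = 1/128. Error 1/128 leaves correlation 1/8 - 8/128 = 1/16, and the three terms per
    coordinate are N/2048 - N/8192 - N/4096 = N/8192. The bound on eps gives N >= 2^30, enough for
    the logarithm to be at most N/8192. *)
Lemma info_cost_lower_bound (R : realType) (eps c delta : R) (k n : nat)
    (Msg : finType) (M : alice_input k.*2 n -> Msg -> R) :
  0 < c -> 0 < eps <= 1 / 128 / 256 -> delta <= 1 / 128 ->
  k.*2%:R = 1 / eps ^+ 2 -> (0 < n)%N -> delta_error eps c delta M ->
  n%:R * k.*2%:R / 64 / 128 <= info_cost eps M * ln 2.
Proof.
move=> c0 /andP[e0 e1] d1 NE n0 [Mok [rec succ]].
have := info_cost_ge e0 c0 n0 NE Mok rec (_ : 0 <= 1 / 128).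
move=> /(_ ltac:(lra)); apply: le_trans.
have lnN : ln k.*2.+1%:R <= 1 / 64 / 128 * k.*2%:R :> R.
  apply: ln_succ_le; first lra.
    by rewrite NE ler_pdivlMr ?exprn_gt0 //; nra.
  by rewrite double_gt0 (k_gt0 e0 NE).
rewrite -!mulrA ler_wpM2l // ?mulrA.
have := ler0n R k.*2.
have : (1 / 8 - 8 * (1 - success_prob eps c M rec)) >= 1 / 16 by lra.
move: (success_prob eps c M rec) (k.*2%:R) lnN => s N lnN h N0.
have := ler_wpM2l N0 h; lra.
Qed.

Theorem theorem2p10 (R : realType) :
  exists c0 delta0 kappa eps0 : R,
    [/\ 0 < c0 < 1, 0 < delta0, 0 < kappa & 0 < eps0] /\
    forall (c delta eps : R) (N k n : nat),
      0 < c <= c0 ->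
      0 < delta <= delta0 ->
      0 < eps <= eps0 ->
      N%:R = 1 / eps ^+ 2 ->
      k%:R = 1 / (2 * eps ^+ 2) ->
      (0 < n)%N ->
      ((kappa * (n%:R / eps ^+ 2))%:E <= IC eps c delta N n)%E /\
      ((kappa * (n%:R / eps ^+ 2))%:E <= one_way_cc eps c delta N n)%E.
Proof.
(* [kappa] is half the constant of [info_cost_lower_bound]; the spare half absorbs the additive bit
   in the communication bound. *)
exists (1 / 2), (1 / 128), (1 / 128 / 128), (1 / 128 / 256).
split; first by split; lra.
move=> c delta eps N k n /andP[c0 _] /andP[_ d1] e01 NE kE n0.
have /andP[e0 e1] := e01.
have Nk : N = k.*2.
  apply/eqP; rewrite -(eqr_nat R) -muln2 natrM NE kE; apply/eqP.
  by field; rewrite gt_eqF.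
subst N.
have ln2p := ln2_gt0 R; have ln21 := ln2_le1 R.
have -> : 1 / 128 / 128 * (n%:R / eps ^+ 2) = n%:R * k.*2%:R / 128 / 128.
  by rewrite NE; field; rewrite gt_eqF.
have nN0 : 0 <= n%:R * k.*2%:R :> R by rewrite mulr_ge0.
split; apply: le_ereal_inf_tmp.
  move=> _ [Msg [M [dM ->]]]; rewrite lee_fin.
  have lb := info_cost_lower_bound c0 e01 d1 NE n0 dM.
  (* Nonnegativity allows the factor ln 2 <= 1 to be dropped. *)
  have I0 : 0 <= info_cost eps M.
    by rewrite -(pmulr_lge0 _ ln2p); apply: le_trans lb; lra.
  nra.
move=> _ [b [M [dM ->]]]; rewrite lee_fin.
have lb := info_cost_lower_bound c0 e01 d1 NE n0 dM.
have [Mok _] := dM; have [M0 M1] := Mok.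
have ub : info_cost eps M * ln 2 <= ln #|{bseq b of bool}|%:R.
  rewrite (info_costE e0 n0 NE).
  apply: mutual_info_le_card M0 M1; last exact: prior_sum1 e0 NE.
  exact: prior_ge0.
(* Strings of length at most b number less than 2^(b + 1), hence b + 1 rather than b. *)
have K2 : ln #|{bseq b of bool}|%:R <= b.+1%:R * ln 2 :> R.
  rewrite mulr_natl -lnXn // ler_ln ?posrE ?exprn_gt0 ?ltr0n //.
    by rewrite -natrX ler_nat card_bseq_bool.
  by apply/card_gt0P; exists [bseq].
have N4 : 128 * 256 <= k.*2%:R :> R.
  by rewrite NE ler_pdivlMr ?exprn_gt0 //; nra.
have n1 : 1 <= n%:R :> R by rewrite ler1n.
have nN : 128 * 256 <= n%:R * k.*2%:R :> R by nra.
rewrite -natr1 in K2.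
have : (b%:R + 1) * ln 2 <= b%:R + 1 :> R.
  by have := ler0n R b; nra.
lra.
Qed.
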